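(* Let $(\mathrm{X},\Sigma,\mu)$ be a measure space and $p\in[1,\infty)$. Let $(f_n)$ be a sequence in $L_p(\mathrm{X})$ and let $f$ be a measurable function. Then $(f_n)$ converges to $f$ in $L_p(\mathrm{X})$ if, and only if, both of the following hold: (i) $(f_n)$ $\alpha_p$-converges to $f$; (ii) $(f_n)$ is uniformly $p$-integrable. The same equivalence holds with (i) replaced by: $(f_n)$ converges almost in $L_p$ to $f$.
   Context: Measurable functions are real-valued and identified $\mu$-a.e.; $L_p(\mathrm{X})$ is the usual Lebesgue space. A sequence of measurable functions $(f_n)$ asymptotically $L_p$-converges ($\alpha_p$-converges) to a measurable function $f$ if there is a sequence of measurable sets $(B_n)$ with $\mu(B_n^c)\to0$ and $\int_{B_n}|f_n-f|^p\,d\mu\to0$ as $n\to\infty$. It converges almost in $L_p$ to $f$ if for each $\delta>0$ there exists a measurable set $E_\delta$ with $\mu(E_\delta)<\delta$ such that $\int_{E_\delta^c}|f_n-f|^p\,d\mu\to0$ as $n\to\infty$. The sequence $(f_n)$ is uniformly $p$-integrable if for every $\varepsilon>0$ there exists $\delta_\varepsilon>0$ such that $\sup_n\int_F|f_n|^p\,d\mu<\varepsilon^p$ for every $F\in\Sigma$ with $\mu(F)<\delta_\varepsilon$. *)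

(* Defs.v *)
From HB Require Import structures.
From mathcomp Require Import all_boot all_order all_algebra.
From mathcomp Require Import all_classical all_reals all_analysis.

Set Implicit Arguments.
Unset Strict Implicit.
Unset Printing Implicit Defensive.

Import Order.TTheory GRing.Theory Num.Theory.
Import numFieldNormedType.Exports.

Local Open Scope classical_set_scope.
Local Open Scope ring_scope.

(* Elements of the L_p space are represented by everywhere-defined real-valued
   functions in [Lfun mu p%:E] (measurable, with finite p-norm). All notions
   below are invariant under mu-a.e. modification of the functions involved. *)

Definition Lp_cvg d (T : measurableType d) (R : realType)
    (mu : {measure set T -> \bar R}) (p : R) (f_ : (T -> R)^nat) (f : T -> R)
    : Prop :=
  f \in Lfun mu p%:E /\
  'N[mu]_p%:E[EFin \o (f_ n \- f)%R]%E @[n --> \oo] --> 0%E.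

Definition alpha_cvg d (T : measurableType d) (R : realType)
    (mu : {measure set T -> \bar R}) (p : R) (f_ : (T -> R)^nat) (f : T -> R)
    : Prop :=
  exists B : (set T)^nat,
    [/\ forall n, measurable (B n),
        mu (~` B n) @[n --> \oo] --> 0%E &
        (\int[mu]_(x in B n) (`|f_ n x - f x| `^ p)%:E)%E @[n --> \oo]
          --> 0%E].

Definition almost_Lp_cvg d (T : measurableType d) (R : realType)
    (mu : {measure set T -> \bar R}) (p : R) (f_ : (T -> R)^nat) (f : T -> R)
    : Prop :=
  forall delta : R, 0 < delta ->
    exists E : set T,
      [/\ measurable E,
          (mu E < delta%:E)%E &
          (\int[mu]_(x in ~` E) (`|f_ n x - f x| `^ p)%:E)%E @[n --> \oo]
            --> 0%E].

Definition uniformly_p_integrable d (T : measurableType d) (R : realType)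
    (mu : {measure set T -> \bar R}) (p : R) (f_ : (T -> R)^nat) : Prop :=
  forall eps : R, 0 < eps ->
    exists2 delta : R, 0 < delta &
      forall F : set T, measurable F -> (mu F < delta%:E)%E ->
        (ereal_sup (range (fun n => \int[mu]_(x in F) (`|f_ n x| `^ p)%:E))
           < (eps `^ p)%:E)%E.

(* Main.v *)
Require Import Defs.
From HB Require Import structures.
From mathcomp Require Import all_boot all_order all_algebra.
From mathcomp Require Import all_classical all_reals all_analysis.
From mathcomp Require Import measurable_realfun ring lra.
Import Order.TTheory GRing.Theory Num.Theory.
Import numFieldNormedType.Exports.
Local Open Scope classical_set_scope.
Local Open Scope ring_scope.

(* For the converse directions, both modes of convergence say that for large n
   the integral of |f_n - f|^p is small outside some set of small measure, and on
   such a set |f_n - f|^p is controlled by |f_n|^p (uniform p-integrability) and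
   |f|^p. That |f|^p also has small integrals over small sets F is seen by
   bounding the integral of min(|f|^p, M) over F: on the good set B compare f
   with f_n, off B use the bound M; then let n, and next M, go to infinity.
   This avoids a.e. convergent subsequences and Fatou's lemma. *)

(** * Null sequences and powers of nonnegative extended reals *)

(** Non-strict bounds on tails suffice: the bound for [e = 1] makes the terms eventually finite,
    although early ones may be [+oo]. *)
Lemma ge0_cvge0P (R : realType) (u : (\bar R)^nat) :
  (forall n, 0 <= u n)%E ->
  u @ \oo --> 0%E <->
  forall e : R, 0 < e -> \forall n \near \oo, (u n <= e%:E)%E.
Proof.
move=> u0; split=> [u_cvg e e0|u_le].
  have /u_cvg u_lt : nbhs 0%E [set x : \bar R | (x < e%:E)%E].
    by apply: open_ereal_lt'; rewrite lte_fin.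
  near=> n; apply: ltW; near: n; exact: u_lt.
apply/fine_cvgP; split.
  apply: filterS (u_le 1 ltr01) => n un1.
  by rewrite ge0_fin_numE// (le_lt_trans un1)// ltry.
apply/cvgrPdist_le => e e0; apply: filterS (u_le e e0) => n une.
rewrite sub0r normrN /= ger0_norm ?fine_ge0//.
by rewrite -lee_fin fineK// ge0_fin_numE// (le_lt_trans une)// ltry.
Unshelve. all: by end_near. Qed.

Lemma ge0_le_poweR (R : realType) (x y : \bar R) (r : R) :
  0 <= r -> (0 <= x)%E -> (x <= y)%E -> (x `^ r <= y `^ r)%E.
Proof.
move=> r0 x0 xy; apply: gt0_ler_poweR => //; rewrite in_itv/= leey andbT//.
exact: le_trans xy.
Qed.

(** * Bounding an integral through truncations of the integrand *)

Section truncation.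
Context d (T : measurableType d) (R : realType) (mu : {measure set T -> \bar R}).
Local Open Scope ereal_scope.

Lemma ge0_integral_setUC (g : T -> R) (F B : set T) :
  measurable_fun [set: T] g -> (forall x, 0 <= g x)%R ->
  measurable F -> measurable B ->
  \int[mu]_(x in F) (g x)%:E =
  \int[mu]_(x in F `&` B) (g x)%:E + \int[mu]_(x in F `&` ~` B) (g x)%:E.
Proof.
move=> mg g0 mF mB.
rewrite -ge0_integral_setU//; last 5 first.
- exact: measurableI.
- by apply: measurableI => //; exact: measurableC.
- by apply: measurable_funTS; exact/measurable_EFinP.
- by move=> x _; rewrite lee_fin.
- by apply/disj_setPS => x [[_ Bx] [_ nBx]].
by rewrite -setIUr setUv setIT.
Qed.

(** At each point the truncations at [M] increase with [M] and equal [g x] once [M] is large, so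
    monotone convergence applies. *)
Lemma ge0_integral_le_trunc (g : T -> R) (F : set T) (c : \bar R) :
  measurable_fun [set: T] g -> (forall x, 0 <= g x)%R -> measurable F ->
  (forall M : nat, \int[mu]_(x in F) (Num.min (g x) M%:R)%:E <= c) ->
  \int[mu]_(x in F) (g x)%:E <= c.
Proof.
move=> mg g0 mF le_c.
have minE x : limn (fun M : nat => (Num.min (g x) M%:R)%:E) = (g x)%:E.
  apply/cvg_lim => //; apply: cvg_near_cst.
  near=> M; congr EFin; apply/min_idPl.
  by near: M; exact: nbhs_infty_ger.
under eq_integral do rewrite -minE.
rewrite monotone_convergence//.
- apply: lime_le; last exact: nearW.
  apply: ereal_nondecreasing_is_cvgn => m n mn; apply: ge0_le_integral => //.
  + by move=> x _; rewrite lee_fin le_min g0 ler0n.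
  + by apply: measurable_funTS; apply/measurable_EFinP; apply: measurable_minr.
  + by apply: measurable_funTS; apply/measurable_EFinP; apply: measurable_minr.
  + by move=> x _; rewrite lee_fin; apply: le_min2 => //; rewrite ler_nat.
- move=> M; apply: measurable_funTS; apply/measurable_EFinP.
  exact: measurable_minr.
- by move=> M x _; rewrite lee_fin le_min g0 ler0n.
- by move=> x _ m n mn; rewrite lee_fin; apply: le_min2 => //; rewrite ler_nat.
Unshelve. all: by end_near. Qed.

(** For a fixed truncation level [M], the part of [F] outside [B] contributes at most [M * eta], and
    [eta] may be chosen after [M]. *)
Lemma ge0_integral_le_approx (g : T -> R) (F : set T) (c : R) :
  measurable_fun [set: T] g -> (forall x, 0 <= g x)%R -> measurable F ->
  (forall eta : R, (0 < eta)%R -> exists B : set T,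
    [/\ measurable B, mu (~` B) <= eta%:E &
        \int[mu]_(x in F `&` B) (g x)%:E <= c%:E]) ->
  \int[mu]_(x in F) (g x)%:E <= c%:E.
Proof.
move=> mg g0 mF approx; apply: ge0_integral_le_trunc => // M.
apply/lee_addgt0Pr => e e0.
(* Dividing by [M.+1] covers the case [M = 0], and [M * (e / M.+1) <= e] still holds. *)
have [|B [mB muB gB]] := approx (e / M.+1%:R)%R; first by rewrite divr_gt0.
have mh : measurable_fun [set: T] (fun x => Num.min (g x) M%:R).
  exact: measurable_minr.
have h0 x : (0 <= Num.min (g x) M%:R)%R by rewrite le_min g0 ler0n.
rewrite (@ge0_integral_setUC _ F B)//; apply: leeD.
  apply: le_trans gB; apply: ge0_le_integral => //.
  - exact: measurableI.
  - by move=> x _; rewrite lee_fin.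
  - by apply: measurable_funTS; exact/measurable_EFinP.
  - by apply: measurable_funTS; exact/measurable_EFinP.
  - by move=> x _; rewrite lee_fin ge_min lexx.
have mFB : measurable (F `&` ~` B) by apply: measurableI => //; exact: measurableC.
apply: (@le_trans _ _ (\int[mu]_(x in F `&` ~` B) (cst M%:R%:E) x)).
  apply: ge0_le_integral => //.
  - by move=> x _; rewrite lee_fin.
  - by apply: measurable_funTS; exact/measurable_EFinP.
  - by move=> x _; rewrite lee_fin ge_min lexx orbT.
rewrite integral_cst//.
apply: (@le_trans _ _ (M.+1%:R%:E * (e / M.+1%:R)%:E)).
  apply: lee_pmul => //; first by rewrite lee_fin ler_nat.
  apply: le_trans muB; apply: le_measure; rewrite ?inE//.
  exact: measurableC.
by rewrite -EFinM mulrCA divff ?mulr1.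
Qed.

End truncation.

(** * Integrals of p-th powers and their relation to the p-norm *)

Section pth_power_integral.
Context d (T : measurableType d) (R : realType) (mu : {measure set T -> \bar R}).
Variable p : R.
Hypothesis p1 : 1 <= p.
Local Open Scope ereal_scope.
Implicit Types (g h : T -> R) (A B : set T).

Let p0 : (0 < p)%R. Proof. exact: lt_le_trans p1. Qed.

Local Notation J A g := (\int[mu]_(x in A) (`|g x| `^ p)%:E).

Lemma measurable_normr_powR g : measurable_fun [set: T] g ->
  measurable_fun [set: T] (fun x => `|g x| `^ p)%R.
Proof.
move=> mg; apply: (measurableT_comp (measurable_powR p)).
exact: measurableT_comp.
Qed.

Lemma le_integral_normr_powR A B g : measurable A -> measurable B ->
  measurable_fun [set: T] g -> A `<=` B -> J A g <= J B g.
Proof.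
move=> mA mB mg AB; apply: ge0_subset_integral => //.
  by apply: measurable_funTS; apply/measurable_EFinP; exact: measurable_normr_powR.
Qed.

(** By symmetry [|b|] is the larger absolute value; then [|a + b| <= 2 * |b|], and it remains to
    take p-th powers. *)
Lemma normrD_powR_le (a b : R) :
  (`|a + b| `^ p <= 2 `^ p * (`|a| `^ p + `|b| `^ p))%R.
Proof.
wlog ab : a b / (`|a| <= `|b|)%R => [wh|].
  have [/wh//|/ltW/wh] := leP `|a|%R `|b|%R.
  by rewrite addrC [X in (_ * X)%R]addrC.
apply: (@le_trans _ _ ((2 * `|b|) `^ p)%R).
  apply: ge0_ler_powR; rewrite ?nnegrE ?mulr_ge0// ?(ltW p0)//.
  by rewrite (le_trans (ler_normD _ _))// mulr_natl mulr2n lerD2r.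
by rewrite powRM// ler_wpM2l ?powR_ge0// lerDr powR_ge0.
Qed.

Lemma integral_normrD_powR_le A g h : measurable A ->
  measurable_fun [set: T] g -> measurable_fun [set: T] h ->
  J A (g \+ h) <= (2 `^ p)%:E * (J A g + J A h).
Proof.
move=> mA mg mh.
have mgp := measurable_funTS (D := A) (measurable_normr_powR _ mg).
have mhp := measurable_funTS (D := A) (measurable_normr_powR _ mh).
rewrite -ge0_integralD//; try exact/measurable_EFinP.
rewrite -ge0_integralZl_EFin ?powR_ge0//; last first.
- by apply: emeasurable_funD; exact/measurable_EFinP.
- by move=> x _; rewrite adde_ge0// lee_fin powR_ge0.
apply: ge0_le_integral => //.
- apply: measurable_funTS; apply/measurable_EFinP/measurable_normr_powR.
  exact: measurable_funD.
- apply: emeasurable_funM => //.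
  by apply: emeasurable_funD; exact/measurable_EFinP.
- by move=> x _; rewrite -EFinD -EFinM lee_fin normrD_powR_le.
Qed.

Lemma Lfun_integralP g : g \in Lfun mu p%:E <->
  measurable_fun [set: T] g /\ J [set: T] g < +oo.
Proof.
have NE : 'N[mu]_p%:E[EFin \o g] `^ p = J [set: T] g.
  by rewrite poweR_Lnorm ?gt_eqF.
rewrite inE; split=> [/andP[/[!inE]/= mg fg]|[mg Jg]].
  by split=> //; rewrite -NE; exact: poweR_lty.
apply/andP; rewrite !inE/=; split => //; apply: (@lty_poweRy _ _ p).
  by rewrite gt_eqF.
by rewrite NE.
Qed.

(** The norm is the p-th root of the integral and both powers are monotone, so a tolerance [e] on
    one side becomes [e^(1/p)] or [e^p] on the other. *)
Lemma Lnorm_cvg0P (g_ : (T -> R)^nat) :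
  'N[mu]_p%:E[EFin \o g_ n] @[n --> \oo] --> 0 <->
  J [set: T] (g_ n) @[n --> \oo] --> 0.
Proof.
have NE n : 'N[mu]_p%:E[EFin \o g_ n] `^ p = J [set: T] (g_ n).
  by rewrite poweR_Lnorm ?gt_eqF.
have EN n : 'N[mu]_p%:E[EFin \o g_ n] = J [set: T] (g_ n) `^ p^-1.
  by rewrite -NE -poweRrM mulfV ?gt_eqF// poweRe1 ?Lnorm_ge0.
have J0 n : 0 <= J [set: T] (g_ n) by apply: integral_ge0.
have N0 n : 0 <= 'N[mu]_p%:E[EFin \o g_ n] by exact: Lnorm_ge0.
rewrite !ge0_cvge0P//; split => cvg0 e e0.
  have := cvg0 (e `^ p^-1)%R (powR_gt0 _ e0); apply: filterS => n Ne.
  rewrite -NE -[e]powRr1 ?(ltW e0)// -(@mulVf _ p) ?gt_eqF// powRrM -poweR_EFin.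
  by apply: ge0_le_poweR => //; exact: ltW.
have := cvg0 (e `^ p)%R (powR_gt0 _ e0); apply: filterS => n Ne.
rewrite EN -[e]powRr1 ?(ltW e0)// -(@mulfV _ p) ?gt_eqF// powRrM -poweR_EFin.
by apply: ge0_le_poweR => //; rewrite invr_ge0 ltW.
Qed.

(** * Absolute continuity and uniform p-integrability *)

(** Here [|g|^p] is integrable, and the integral of an integrable function is absolutely
    continuous. *)
Lemma Lfun_absolutely_continuous g : g \in Lfun mu p%:E ->
  forall e : R, (0 < e)%R -> exists2 delta : R, (0 < delta)%R &
    forall F, measurable F -> mu F < delta%:E -> J F g <= e%:E.
Proof.
move=> Lg e e0; have intg := Lfun_integrable p1 Lg.
have [delta [delta0 Hd]] := integral_normr_continuous intg e0.
exists delta => // F mF /(Hd F mF)/ltW; rewrite -lee_fin.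
rewrite /Rintegral fineK.
  by under eq_integral do rewrite ger0_norm ?powR_ge0//.
under eq_integral do rewrite ger0_norm ?powR_ge0//.
by apply: integrable_fin_num => //; exact: integrableS intg.
Qed.

(** Substituting [e = eps^p] turns the bound on the supremum into separate bounds for each [n],
    which combine directly with integral estimates. *)
Lemma uniformly_p_integrableP (f_ : (T -> R)^nat) :
  uniformly_p_integrable mu p f_ <->
  forall e : R, (0 < e)%R -> exists2 delta : R, (0 < delta)%R &
    forall F, measurable F -> mu F < delta%:E -> forall n, J F (f_ n) <= e%:E.
Proof.
split=> [ui e e0|ac eps eps0].
  have [delta delta0 ui_delta] := ui _ (powR_gt0 p^-1 e0).
  exists delta => // F mF /(ui_delta F mF) + n.
  rewrite -powRrM mulVf ?gt_eqF// powRr1 ?(ltW e0)// => /ltW; apply: le_trans.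
  by apply: ereal_sup_ubound; exists n.
(* The half keeps the supremum strictly below [eps^p]. *)
have e0 : (0 < eps `^ p / 2)%R by rewrite divr_gt0// powR_gt0.
have [delta delta0 ac_delta] := ac _ e0.
exists delta => // F mF muF; apply: (@le_lt_trans _ _ (eps `^ p / 2)%:E).
  by apply: ge_ereal_sup => _ [n _ <-]; exact: ac_delta.
by rewrite lte_fin gtr_pMr ?powR_gt0// invf_lt1// ltr1n.
Qed.

Lemma Lp_cvgP (f_ : (T -> R)^nat) f :
  Lp_cvg mu p f_ f <->
  f \in Lfun mu p%:E /\ J [set: T] (f_ n \- f) @[n --> \oo] --> 0.
Proof. by rewrite /Lp_cvg Lnorm_cvg0P. Qed.

(** Meant for the initial terms, over which convergence gives no control: being finitely many, they
    share the smallest of their thresholds. *)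
Lemma Lfun_seq_absolutely_continuous (f_ : (T -> R)^nat) (N : nat) :
  (forall n, f_ n \in Lfun mu p%:E) ->
  forall e : R, (0 < e)%R -> exists2 delta : R, (0 < delta)%R &
    forall F, measurable F -> mu F < delta%:E ->
    forall n, (n < N)%N -> J F (f_ n) <= e%:E.
Proof.
move=> Lf e e0; elim: N => [|N [delta delta0 IH]]; first by exists 1%R.
have [delta' delta'0 ac] := Lfun_absolutely_continuous _ (Lf N) _ e0.
exists (Num.min delta delta'); first by rewrite lt_min delta0.
move=> F mF; rewrite EFin_min lt_min => /andP[muF muF'] n.
rewrite ltnS leq_eqVlt => /predU1P[->|nN]; [exact: ac|exact: IH].
Qed.

(** For [n >= N], in [f_n = (f_n - f) + f] the first term is small by convergence and the second by
    absolute continuity; the terms before [N] form a finite family. *)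
Lemma Lp_cvg_uniformly_p_integrable (f_ : (T -> R)^nat) f :
  (forall n, f_ n \in Lfun mu p%:E) ->
  Lp_cvg mu p f_ f -> uniformly_p_integrable mu p f_.
Proof.
move=> Lf /Lp_cvgP[Lff]; rewrite ge0_cvge0P => [f_cvg|n]; last exact: integral_ge0.
apply/uniformly_p_integrableP => e e0.
have [mf _] := (Lfun_integralP f).1 Lff.
(* Chosen so that [2^p * (e' + e') = e]. *)
pose e' := (e / (2 `^ p * 2))%R.
have C0 : (0 < 2 `^ p :> R)%R by rewrite powR_gt0.
have e'0 : (0 < e')%R by rewrite divr_gt0// mulr_gt0.
have [N _ f_near] := f_cvg _ e'0.
have [d1 d10 ac1] := Lfun_seq_absolutely_continuous _ N Lf _ e0.
have [d2 d20 ac2] := Lfun_absolutely_continuous _ Lff _ e'0.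
exists (Num.min d1 d2); first by rewrite lt_min d10.
move=> F mF; rewrite EFin_min lt_min => /andP[muF1 muF2] n.
have [nN|Nn] := ltnP n N; first exact: ac1.
have [mfn _] := (Lfun_integralP (f_ n)).1 (Lf n).
have -> : f_ n = ((f_ n \- f) \+ f)%R by apply/funext => x /=; rewrite subrK.
apply: le_trans (integral_normrD_powR_le _ _ _ mF _ mf) _.
  exact: measurable_funB.
have -> : e%:E = (2 `^ p)%:E * (e'%:E + e'%:E).
  rewrite -EFinD -EFinM; congr EFin; rewrite /e'.
  by field; rewrite gt_eqF.
apply: lee_wpmul2l; first by rewrite lee_fin ltW.
apply: leeD; last exact: ac2.
apply: le_trans (f_near n Nn); apply: le_integral_normr_powR => //.
exact: measurable_funB.
Qed.

(** * A common consequence of the two modes of convergence *)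

(* Common weakening of alpha_p-convergence and of almost L_p convergence; the
   set B may depend on both eta and n. *)
Definition cvg_off_small_sets (f_ : (T -> R)^nat) f :=
  forall eta : R, (0 < eta)%R -> \forall n \near \oo, exists B,
    [/\ measurable B, mu (~` B) < eta%:E & J B (f_ n \- f) <= eta%:E].

Lemma alpha_cvg_off_small_sets (f_ : (T -> R)^nat) f :
  alpha_cvg mu p f_ f -> cvg_off_small_sets f_ f.
Proof.
move=> [B [mB muB JB]] eta eta0.
(* Halving turns the non-strict tail bound into the strict one required for the measure of the
   complement. *)
have eta20 : (0 < eta / 2)%R by rewrite divr_gt0.
rewrite ge0_cvge0P in muB; last by [].
rewrite ge0_cvge0P in JB; last by move=> n; exact: integral_ge0.
near=> n; exists (B n); split => //.
  apply: (@le_lt_trans _ _ (eta / 2)%:E); last first.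
    by rewrite lte_fin gtr_pMr// invf_lt1// ltr1n.
  by near: n; exact: muB.
by near: n; exact: JB.
Unshelve. all: by end_near. Qed.

Lemma almost_Lp_cvg_off_small_sets (f_ : (T -> R)^nat) f :
  almost_Lp_cvg mu p f_ f -> cvg_off_small_sets f_ f.
Proof.
move=> almost eta eta0; have [E [mE muE JE]] := almost _ eta0.
rewrite ge0_cvge0P in JE; last by move=> n; exact: integral_ge0.
near=> n; exists (~` E); rewrite setCK; split => //; first exact: measurableC.
by near: n; exact: JE.
Unshelve. all: by end_near. Qed.

(** * From convergence off small sets to convergence in L_p *)

Section converse.
Variables (f_ : (T -> R)^nat) (f : T -> R).
Hypothesis Lf_ : forall n, f_ n \in Lfun mu p%:E.
Hypothesis mf : measurable_fun [set: T] f.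
Hypothesis f_cvg : cvg_off_small_sets f_ f.

Let C : R := (2 `^ p)%R.
Let C0 : (0 < C)%R. Proof. exact: powR_gt0. Qed.
Let mf_ n : measurable_fun [set: T] (f_ n).
Proof. exact: ((Lfun_integralP _).1 (Lf_ n)).1. Qed.
Let mf_f n : measurable_fun [set: T] (f_ n \- f)%R.
Proof. exact: measurable_funB. Qed.

(** For each [eta] a single index [N] is enough: [f = f_N + (f - f_N)] bounds the integral over the
    part of [F] in [B], and the bound does not depend on [eta]. At this point [f] is not yet known
    to be in L_p. *)
Lemma limit_integral_le (F : set T) (e : R) : (0 < e)%R -> measurable F ->
  (forall n, J F (f_ n) <= e%:E) -> J F f <= (C * (e + e))%:E.
Proof.
move=> e0 mF JF; apply: ge0_integral_le_approx => //.
  exact: measurable_normr_powR.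
move=> eta eta0.
(* [eta] limits the measure of the complement of [B], and [e] the integral of [|f_N - f|^p] over
   [B]. *)
have [|N _ /(_ N (leqnn N))[B [mB muB JB]]] := f_cvg (Num.min eta e).
  by rewrite lt_min eta0.
exists B; split=> //.
  by apply: le_trans (ltW muB) _; rewrite lee_fin ge_min lexx.
have mFB : measurable (F `&` B) by exact: measurableI.
have -> : f = (f_ N \+ (f \- f_ N))%R by apply/funext => x /=; rewrite addrC subrK.
apply: le_trans (integral_normrD_powR_le _ _ _ mFB _ _) _ => //.
  exact: measurable_funB.
rewrite EFinM EFinD; apply: lee_wpmul2l; first by rewrite lee_fin ltW.
apply: leeD.
  by apply: le_trans (JF N); apply: le_integral_normr_powR.
apply: (@le_trans _ _ (Num.min eta e)%:E); last by rewrite lee_fin ge_min lexx orbT.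
apply: le_trans JB.
under eq_integral do rewrite /= distrC.
exact: (@le_integral_normr_powR (F `&` B) B (f_ N \- f)%R).
Qed.

(** Over [B] the difference is small by assumption. Over the complement, which has small measure,
    [f_n] and [f] are bounded separately, by uniform p-integrability and by [limit_integral_le]. *)
Lemma Lp_cvg_off_small_sets : uniformly_p_integrable mu p f_ -> Lp_cvg mu p f_ f.
Proof.
move=> /uniformly_p_integrableP ui.
have J_cvg e : (0 < e)%R ->
    \forall n \near \oo, J [set: T] (f_ n \- f) <= e%:E.
  (* [K] collects the error terms in units of [e']: one over [B], and [C * (1 + C * 2)] over its
     complement from [f_n] and [f]. *)
  move=> e0; pose K := (1 + C * (1 + C * 2))%R.
  have K0 : (0 < K)%R by rewrite /K; nra.
  pose e' := (e / K)%R; have e'0 : (0 < e')%R by rewrite divr_gt0.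
  have [delta delta0 ui_delta] := ui _ e'0.
  have [|N _ f_near] := f_cvg (Num.min delta e'); first by rewrite lt_min delta0.
  exists N => // n /f_near[B [mB]].
  rewrite EFin_min lt_min le_min => /andP[muB _] /andP[_ JB].
  have mBC : measurable (~` B) by exact: measurableC.
  rewrite (@ge0_integral_setUC _ _ _ _ _ _ B)//; last exact: measurable_normr_powR.
  rewrite !setTI.
  have JBC := ui_delta _ mBC muB.
  have -> : e = (e' + C * (e' + C * (e' + e')))%R.
    by rewrite /e' /K; field; rewrite gt_eqF.
  rewrite EFinD [(C * _)%:E]EFinM EFinD.
  apply: leeD => //.
  have -> : (f_ n \- f = f_ n \+ (fun x => - f x))%R by [].
  apply: le_trans (integral_normrD_powR_le _ _ _ mBC _ _) _ => //.
    exact: measurableT_comp.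
  apply: lee_wpmul2l; first by rewrite lee_fin ltW.
  apply: leeD; first exact: JBC.
  under eq_integral do rewrite normrN.
  exact: limit_integral_le.
apply/Lp_cvgP; rewrite ge0_cvge0P => [|n]; last exact: integral_ge0.
(* Membership of [f] follows from one index at which the difference has a finite integral, since
   [f = f_N - (f_N - f)]. *)
split => //; have [N _ /(_ N (leqnn N)) JN] := J_cvg 1%R ltr01.
have LfN : (f_ N \- f)%R \in Lfun mu p%:E.
  by apply/Lfun_integralP; split => //; apply: le_lt_trans JN _; rewrite ltry.
have -> : (f = f_ N \+ (fun x => - (f_ N \- f) x))%R by apply/funext => x; rewrite /= opprB addrC subrK.
apply/Lfun_integralP; split.
  by apply: measurable_funD => //; exact: measurableT_comp.
apply: le_lt_trans (integral_normrD_powR_le _ _ _ measurableT _ _) _ => //.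
  exact: measurableT_comp.
rewrite lte_mul_pinfty ?lee_fin ?powR_ge0//.
under [X in _ + X]eq_integral do rewrite normrN.
apply: lte_add_pinfty; first exact: ((Lfun_integralP _).1 (Lf_ N)).2.
exact: ((Lfun_integralP _).1 LfN).2.
Qed.

End converse.

(** * From convergence in L_p to the other two modes, with empty exceptional sets *)

Lemma Lp_cvg_alpha_cvg (f_ : (T -> R)^nat) f :
  Lp_cvg mu p f_ f -> alpha_cvg mu p f_ f.
Proof.
move=> /Lp_cvgP[_ Jcvg]; exists (fun=> [set: T]); split => //.
by rewrite setCT measure0; exact: cvg_cst.
Qed.

Lemma Lp_cvg_almost_Lp_cvg (f_ : (T -> R)^nat) f :
  Lp_cvg mu p f_ f -> almost_Lp_cvg mu p f_ f.
Proof.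
move=> /Lp_cvgP[_ Jcvg] delta delta0; exists set0.
by rewrite measure0 setC0 lte_fin.
Qed.

End pth_power_integral.

(** * The two characterizations of convergence in L_p *)

Theorem theorem5p3 (d : measure_display) (T : measurableType d) (R : realType)
    (mu : {measure set T -> \bar R}) (p : R) (hp : 1 <= p)
    (f_ : (T -> R)^nat) (hf_ : forall n : nat, f_ n \in Lfun mu p%:E)
    (f : T -> R) (hf : measurable_fun [set: T] f) :
  (Lp_cvg mu p f_ f <->
     alpha_cvg mu p f_ f /\ uniformly_p_integrable mu p f_) /\
  (Lp_cvg mu p f_ f <->
     almost_Lp_cvg mu p f_ f /\ uniformly_p_integrable mu p f_).
Proof.
split; split=> [f_cvg|[f_cvg]].
- by split; [exact: Lp_cvg_alpha_cvg|exact: Lp_cvg_uniformly_p_integrable f_cvg].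
- by apply: Lp_cvg_off_small_sets => //; exact: alpha_cvg_off_small_sets.
- by split; [exact: Lp_cvg_almost_Lp_cvg|exact: Lp_cvg_uniformly_p_integrable f_cvg].
- by apply: Lp_cvg_off_small_sets => //; exact: almost_Lp_cvg_off_small_sets.
Qed.
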